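(* Let $l,l'\subset\mathbb R^{2n}$ be complementary $n$-dimensional rational subspaces. Then the union of the $G_\Lambda$-orbits of the $(l,l')$-Lagrangian split forms is dense in $\mathcal L_l$.
   Context: A linear symplectic form on $\mathbb T^{2n}=\mathbb R^{2n}/\mathbb Z^{2n}$ is a form whose lift to $\mathbb R^{2n}$ has constant coefficients; only symplectic forms inducing the standard orientation are considered. $\mathcal L$ denotes the space of lifts to $\mathbb R^{2n}$ of linear symplectic forms $\omega$ on $\mathbb T^{2n}$ of total volume $1$ (that is, $\int_{\mathbb T^{2n}}\omega^n=1$), with the topology induced from the space of bilinear forms on $\mathbb R^{2n}$. A vector subspace $l\subset\mathbb R^{2n}$ of real dimension $n$ is rational if it is spanned over $\mathbb R$ by vectors in $\mathbb Z^{2n}$. Two $n$-dimensional rational subspaces $l,l'$ are complementary if $(l\cap\mathbb Z^{2n})\oplus(l'\cap\mathbb Z^{2n})=\mathbb Z^{2n}$. For a rational $n$-dimensional $l$, set $\mathcal L_l:=\{\tilde\omega\in\mathcal L : \tilde\omega|_l\equiv 0\}$, $G:=\{g\in SL(2n,\mathbb R): g|_l=\mathrm{Id}\}$ and $G_\Lambda:=G\cap SL(2n,\mathbb Z)$. The group $G$ acts naturally on $\mathcal L_l$ (by linear change of variables in bilinear forms). A form $\tilde\omega\in\mathcal L$ is $(l,l')$-Lagrangian split if both $l$ and $l'$ are Lagrangian with respect to $\tilde\omega$, that is, $\tilde\omega\in\mathcal L_l\cap\mathcal L_{l'}$. *)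

(* Defs.v *)
From HB Require Import structures.
From mathcomp Require Import all_boot all_order all_algebra all_fingroup.
From mathcomp Require Import all_classical all_reals all_analysis.

Set Implicit Arguments.
Unset Strict Implicit.
Unset Printing Implicit Defensive.

Import Order.TTheory GRing.Theory Num.Theory.
Import numFieldNormedType.Exports.
Local Open Scope classical_set_scope.
Local Open Scope ring_scope.

(** A bilinear form on R^m is given by its Gram matrix A, so that the topology
    on bilinear forms is the library topology of 'M[R]_m. *)
Definition bilin (R : realType) (m : nat) (A : 'M[R]_m) (u v : 'cV[R]_m) : R :=
  (u^T *m A *m v) 0 0.

Definition alternating_form (R : realType) (m : nat) (A : 'M[R]_m) : Prop :=
  forall u : 'cV[R]_m, bilin A u u = 0.

Definition nondegenerate_form (R : realType) (m : nat) (A : 'M[R]_m) : Prop :=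
  forall u : 'cV[R]_m, (forall v : 'cV[R]_m, bilin A u v = 0) -> u = 0.

(** Exterior product of a p-form and a q-form, both seen as functions of
    families of vectors, normalized so that
    (dx /\ dy)(u, v) = dx u * dy v - dx v * dy u. *)
Definition wedge (R : realType) (V : Type) (p q : nat)
    (a : ('I_p -> V) -> R) (b : ('I_q -> V) -> R) (v : 'I_(p + q) -> V) : R :=
  (p`! * q`!)%:R^-1 *
  \sum_(s : 'S_(p + q)) (-1) ^+ s *
    (a (fun i => v (s (lshift q i))) * b (fun j => v (s (rshift p j)))).

(** The k-th exterior power of a 2-form; 2 + k.*2 and k.+1.*2 are
    convertible. *)
Fixpoint wedge_pow (R : realType) (V : Type) (w : ('I_2 -> V) -> R) (k : nat) :
    ('I_k.*2 -> V) -> R :=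
  match k with
  | 0 => fun=> 1
  | k'.+1 => wedge w (@wedge_pow R V w k')
  end.

Definition two_form (R : realType) (m : nat) (A : 'M[R]_m)
    (v : 'I_2 -> 'cV[R]_m) : R :=
  bilin A (v ord0) (v ord_max).

(** The integral over T^{2n} of the n-th exterior power of the form A. This
    power is c dx_1 /\ ... /\ dx_{2n} with c constant, and the torus, with the
    standard orientation, has Lebesgue volume 1, so that the integral is c,
    i.e., the value of the power at the standard basis. *)
Definition total_volume (R : realType) (n : nat) (A : 'M[R]_n.*2) : R :=
  wedge_pow (two_form A) (fun i : 'I_n.*2 => delta_mx i 0).

(** Constant coefficient forms are closed, so that only nondegeneracy has to be
    required; the last condition says that the induced orientation is the
    standard one. *)
Definition linear_symplectic (R : realType) (n : nat) (A : 'M[R]_n.*2) : Prop :=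
  [/\ alternating_form A, nondegenerate_form A & 0 < total_volume A].

Definition unit_volume_forms (R : realType) (n : nat) : set 'M[R]_n.*2 :=
  [set A | linear_symplectic A /\ total_volume A = 1].

Definition integral_vec (R : realType) (m : nat) (v : 'cV[R]_m) : Prop :=
  v \is a mxOver Num.int.

Definition rational_subspace (R : realType) (m : nat)
    (l : {vspace 'cV[R]_m}) : Prop :=
  exists2 X : seq 'cV[R]_m,
    (forall v, v \in X -> integral_vec v) & l = <<X>>%VS.

(** Internal direct sum of the lattices of integral vectors of l and l'. *)
Definition complementary (R : realType) (m : nat)
    (l l' : {vspace 'cV[R]_m}) : Prop :=
  (forall v : 'cV[R]_m, integral_vec v ->
     exists u u' : 'cV[R]_m,
       [/\ u \in l /\ integral_vec u, u' \in l' /\ integral_vec u' &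
           v = u + u']) /\
  (forall v : 'cV[R]_m, v \in l -> v \in l' -> integral_vec v -> v = 0).

Definition lagrangian_forms (R : realType) (n : nat)
    (l : {vspace 'cV[R]_n.*2}) : set 'M[R]_n.*2 :=
  [set A | unit_volume_forms A /\
           forall u v, u \in l -> v \in l -> bilin A u v = 0].

Definition lagrangian_split_forms (R : realType) (n : nat)
    (l l' : {vspace 'cV[R]_n.*2}) : set 'M[R]_n.*2 :=
  lagrangian_forms l `&` lagrangian_forms l'.

Definition fixing_group (R : realType) (m : nat) (l : {vspace 'cV[R]_m}) :
    set 'M[R]_m :=
  [set g | \det g = 1 /\ forall v, v \in l -> g *m v = v].

Definition integral_fixing_group (R : realType) (m : nat)
    (l : {vspace 'cV[R]_m}) : set 'M[R]_m :=
  fixing_group l `&` [set g | g \is a mxOver Num.int].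

(** The form (u, v) |-> A (g u) (g v). This is a right action; its orbits are
    those of the left action of g by the inverse change of variables. *)
Definition change_var (R : realType) (m : nat) (g A : 'M[R]_m) : 'M[R]_m :=
  g^T *m A *m g.

Definition orbit_of (R : realType) (m : nat) (H : set 'M[R]_m) (A : 'M[R]_m) :
    set 'M[R]_m :=
  [set change_var g A | g in H].

(** The library predicate [dense] only concerns the whole space. *)
Definition dense_in (T : topologicalType) (S Y : set T) : Prop :=
  S `<=` Y /\ Y `<=` closure S.

(* Main.v *)
Require Import Defs.
From mathcomp Require Import all_boot all_order all_algebra all_fingroup.
From mathcomp Require Import ring lra.
From mathcomp Require Import all_classical all_reals all_analysis.

Set Implicit Arguments.
Unset Strict Implicit.
Unset Printing Implicit Defensive.

Import Order.TTheory GRing.Theory Num.Theory.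
Import numFieldNormedType.Exports.
Local Open Scope classical_set_scope.
Local Open Scope ring_scope.

(** Complementarity makes the projection [P] onto [l] along [l'] an integral
    matrix; put [Q := 1 - P]. A form [A] vanishing on [l] is then
    [W - W^T + C], with a mixed block [W = P^T A Q] pairing [l] with [l'] and an
    alternating block [C = Q^T A Q] living on [l'], and it is split exactly when
    [C = 0]. For an integral [N] mapping [l'] to [l] and killing [l], the shear
    [1 + N] lies in the integral group fixing [l], and it carries the split form
    [W - W^T] to [W - W^T + (N^T W - W^T N)]. So the question is to realize [C]
    as [N^T W - W^T N] after an arbitrarily small change of [W].

    Approximate [W] by [X / m] with [X] integral, and take [N := k P X] with [k]
    a large integer. Then [N^T X = k X^T X] is symmetric, so that [X / m] alone
    contributes nothing, and a correction [D / k] of [X / m] contributes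
    [(P X)^T D - D^T (P X)], whatever [k]. Since the form is nondegenerate,
    [P X] is invertible from [l'] to [l], hence [(P X)^T D = C / 2] has a
    solution [D], which gives [C] exactly ([mixed_block_preimage]). The
    correction [D / k] tends to 0, so the forms reached accumulate at
    [X / m - (X / m)^T + C], and these accumulate at [A]
    ([closure_split_reachable]).

    The forms produced so far need not have volume 1. The volume is continuous,
    homogeneous of degree [n] and multiplied by [\det g] under a change of
    variables ([total_volume_change_var]); the forms near [A] thus have a volume
    near 1, and rescaling them to volume 1 moves them little and commutes with
    the group action. A form of nonzero volume is automatically nondegenerate
    ([nondegenerate_total_volume]), so the rescaled forms are symplectic. *)

(** * Change of variables for exterior powers *)

(** Multilinearity, in the fully expanded form: unlike linearity in one slot at
    a time, it needs no updating of families of vectors, and the expansion of a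
    determinant starts from it. *)
Definition multilinear (R : realType) (V : lmodType R) (p : nat)
    (F : ('I_p -> V) -> R) : Prop :=
  forall (m : nat) (G : 'I_p -> 'I_m -> R) (e : 'I_m -> V),
    F (fun i => \sum_j G i j *: e j) =
    \sum_(f : {ffun 'I_p -> 'I_m}) (\prod_i G i (f i)) * F (e \o f).

Definition antisymmetric_map (R : realType) (V : Type) (p : nat)
    (F : ('I_p -> V) -> R) : Prop :=
  forall (s : 'S_p) (v : 'I_p -> V), F (v \o s) = (-1) ^+ s * F v.

(** The sum over all permutations makes a wedge antisymmetric even when the
    factors are not. *)
Lemma antisymmetric_wedge (R : realType) (V : Type) (p q : nat)
    (a : ('I_p -> V) -> R) (b : ('I_q -> V) -> R) :
  antisymmetric_map (wedge a b).
Proof.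
move=> t v; rewrite /wedge mulrCA; congr (_ * _).
rewrite (reindex_inj (mulIg t^-1)%g) /= mulr_sumr.
apply: eq_bigr => s _; rewrite odd_permM odd_permV signr_addb.
rewrite [_ ^+ s * _]mulrC -mulrA; congr (_ * (_ * (a _ * b _)));
  by apply/funext => i; rewrite -permM mulgKV.
Qed.

Lemma big_ffun_split (R : realType) (T : finType) (p q : nat)
    (H : {ffun 'I_(p + q) -> T} -> R) :
  \sum_f H f = \sum_(f : {ffun 'I_p -> T}) \sum_(g : {ffun 'I_q -> T})
    H [ffun i : 'I_(p + q) =>
         match fintype.split i with inl j => f j | inr j => g j end].
Proof.
rewrite pair_big /=.
rewrite (reindex (fun fg : {ffun 'I_p -> T} * {ffun 'I_q -> T} =>
  [ffun i : 'I_(p + q) =>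
     match fintype.split i with inl j => fg.1 j | inr j => fg.2 j end])) //=.
exists (fun f : {ffun 'I_(p + q) -> T} =>
    ([ffun j => f (lshift q j)], [ffun j => f (rshift p j)])).
- case=> f g _; congr (_, _); apply/ffunP => j; rewrite !ffunE.
  + by rewrite (unsplitK (inl j)).
  + by rewrite (unsplitK (inr j)).
- move=> f _; apply/ffunP => i; rewrite !ffunE.
  by rewrite -[in RHS](splitK i); case: (fintype.split i) => j; rewrite ffunE.
Qed.

(** Each permutation [s] contributes a product of an expansion in the first [p]
    slots and one in the last [q] slots; pairs of choice functions on the two
    blocks are choice functions on all slots, read through [s]. *)
Lemma multilinear_wedge (R : realType) (V : lmodType R) (p q : nat)
    (a : ('I_p -> V) -> R) (b : ('I_q -> V) -> R) :
  multilinear a -> multilinear b -> multilinear (wedge a b).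
Proof.
move=> ma mb m G e; rewrite /wedge.
under [RHS]eq_bigr do rewrite mulrCA mulr_sumr.
rewrite -mulr_sumr; congr (_ * _); rewrite exchange_big /=.
apply: eq_bigr => s _.
rewrite (ma _ (fun i j => G (s (lshift q i)) j)).
rewrite (mb _ (fun i j => G (s (rshift p i)) j)).
(* The choice functions of the total expansion are reindexed by [s]. *)
have invK : cancel
    (fun f : {ffun 'I_(p + q) -> 'I_m} => [ffun i => f (s i)])
    (fun f => [ffun i => f (s^-1 i)%g]).
  by move=> f; apply/ffunP => i; rewrite !ffunE permKV.
have Kinv : cancel
    (fun f : {ffun 'I_(p + q) -> 'I_m} => [ffun i => f (s^-1 i)%g])
    (fun f => [ffun i => f (s i)]).
  by move=> f; apply/ffunP => i; rewrite !ffunE permK.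
rewrite [RHS](reindex_inj (can_inj Kinv)) /= big_ffun_split /=.
rewrite big_distrl mulr_sumr; apply: eq_bigr => f _ /=.
rewrite big_distrr mulr_sumr; apply: eq_bigr => g _ /=.
rewrite [RHS]mulrCA; congr (_ * _).
rewrite (reindex_inj (@perm_inj _ s)) /= big_split_ord /=.
under [X in _ = X * _ * _]eq_bigr => i _ do
  rewrite !ffunE permK (unsplitK (inl i)).
under [X in _ = _ * X * _]eq_bigr => i _ do
  rewrite !ffunE permK (unsplitK (inr i)).
rewrite mulrACA; congr (_ * (a _ * b _));
  apply/funext => i /=; rewrite !ffunE permK.
- by rewrite (unsplitK (inl i)).
- by rewrite (unsplitK (inr i)).
Qed.

Lemma multilinear_two_form (R : realType) (m : nat) (A : 'M[R]_m) :
  multilinear (two_form A).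
Proof.
move=> k G e; rewrite (@big_ffun_split R 'I_k 1 1) /two_form /bilin.
have bij1 (H : {ffun 'I_1 -> 'I_k} -> R) :
    \sum_f H f = \sum_j H [ffun=> j].
  rewrite (reindex (fun j : 'I_k => [ffun _ : 'I_1 => j])) //=.
  exists (fun f : {ffun 'I_1 -> 'I_k} => f ord0) => f _; first by rewrite ffunE.
  by apply/ffunP => i; rewrite ffunE (ord1 i).
rewrite bij1 (raddf_sum (@trmx R m 1)) /= mulmx_suml mulmx_suml summxE.
apply: eq_bigr => i _; rewrite bij1 mulmx_sumr summxE.
apply: eq_bigr => j _; rewrite !big_ord_recl big_ord0 mulr1 /= !ffunE.
have -> : fintype.split (ord0 : 'I_(1 + 1)) = inl ord0.
  by case: fintype.splitP => // k0 _; rewrite (ord1 k0).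
have -> : fintype.split (lift ord0 ord0 : 'I_(1 + 1)) = inr ord0.
  by case: fintype.splitP => [[[]]|k0 _] //; rewrite (ord1 k0).
have -> : fintype.split (ord_max : 'I_(1 + 1)) = inr ord0.
  by case: fintype.splitP => [[[]]|k0 _] //; rewrite (ord1 k0).
have trmxZ c (u : 'cV[R]_m) : (c *: u)^T = c *: u^T.
  by apply/matrixP => x y; rewrite !mxE.
rewrite !ffunE trmxZ -!scalemxAl -scalemxAr !mxE mulrA.
by rewrite (_ : lift ord0 ord0 = ord_max) //; apply: val_inj.
Qed.

Lemma multilinear_wedge_pow (R : realType) (m : nat) (A : 'M[R]_m) (k : nat) :
  multilinear (@wedge_pow R _ (two_form A) k).
Proof.
elim: k => [|k IH] /=; last first.
  exact: (multilinear_wedge (multilinear_two_form A) IH).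
move=> j G e; have no : 'I_0.*2 -> 'I_j by case.
rewrite (bigD1 (finfun no)) //= big_ord0 mulr1.
rewrite big1 ?addr0 // => f /eqP[].
by apply/ffunP => -[].
Qed.

Lemma antisymmetric_wedge_pow (R : realType) (V : Type) (w : ('I_2 -> V) -> R)
    (k : nat) : antisymmetric_map (@wedge_pow R V w k).
Proof.
case: k => [|k]; last exact: (antisymmetric_wedge w (@wedge_pow R V w k)).
move=> s v /=; rewrite mulr1 (_ : s = 1%g) ?odd_perm1 //.
by apply/permP => -[].
Qed.

Lemma antisymmetric_map_repeat (R : realType) (V : Type) (p : nat)
    (F : ('I_p -> V) -> R) (v : 'I_p -> V) (i j : 'I_p) :
  antisymmetric_map F -> i != j -> v i = v j -> F v = 0.
Proof.
move=> antiF nij vij; have := antiF (tperm i j) v.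
rewrite odd_tperm nij expr1 mulN1r => /eqP.
have -> : v \o tperm i j = v.
  by apply/funext => k /=; case: tpermP => [->|->|].
by rewrite -addr_eq0 -mulr2n mulrn_eq0 => /eqP.
Qed.

(** This is the proof that determinants are multiplicative: in the expansion the
    noninjective choices vanish, and the injective ones are permutations, whose
    signs rebuild the determinant. *)
Lemma multilinear_det (R : realType) (V : lmodType R) (p : nat)
    (F : ('I_p -> V) -> R) (g : 'M[R]_p) (e : 'I_p -> V) :
  multilinear F -> antisymmetric_map F ->
  F (fun i => \sum_j g j i *: e j) = \det g * F e.
Proof.
move=> multF antiF; rewrite (multF _ (fun i j => g j i)).
rewrite (bigID (fun f : {ffun 'I_p -> 'I_p} => injectiveb f)) /=.
rewrite [X in _ + X]big1 ?addr0 => [|f /injectivePn[i [j nij fij]]]; last first.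
  by rewrite (antisymmetric_map_repeat antiF nij) ?mulr0 //= fij.
rewrite (reindex (@pval _)) /=; last first.
  pose in_Sn := insubd (1%g : 'S_p).
  by exists in_Sn => /= f Uf; first apply: val_inj; apply: insubdK.
rewrite -det_tr mulr_suml; apply: eq_big => /= [s | s _]; first exact: (valP s).
have -> : e \o pval s = e \o s by apply/funext => i /=; rewrite pvalE.
rewrite antiF mulrA; congr (_ * _); rewrite mulrC; congr (_ * _).
by apply: eq_bigr => i _; rewrite mxE pvalE.
Qed.

Lemma bilin_change_var (R : realType) (m : nat) (g A : 'M[R]_m)
    (u v : 'cV[R]_m) :
  bilin (change_var g A) u v = bilin A (g *m u) (g *m v).
Proof. by rewrite /bilin /change_var trmx_mul !mulmxA. Qed.

Lemma wedge_pow_change_var (R : realType) (m : nat) (g A : 'M[R]_m) (k : nat)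
    (v : 'I_k.*2 -> 'cV[R]_m) :
  wedge_pow (two_form (change_var g A)) v =
  wedge_pow (two_form A) (fun i => g *m v i).
Proof.
elim: k v => [//|k IH] v /=; rewrite /wedge; congr (_ * _).
by apply: eq_bigr => s _; rewrite /two_form bilin_change_var IH.
Qed.

Lemma total_volume_change_var (R : realType) (n : nat) (g A : 'M[R]_n.*2) :
  total_volume (change_var g A) = \det g * total_volume A.
Proof.
rewrite /total_volume wedge_pow_change_var.
rewrite -(multilinear_det g); last 2 first.
- exact: multilinear_wedge_pow.
- exact: antisymmetric_wedge_pow.
congr wedge_pow; apply/funext => i; rewrite -colE; apply/colP => k.
rewrite mxE summxE (bigD1 k) //= big1 ?addr0 => [|j njk].
  by rewrite !mxE !eqxx mulr1.
by rewrite !mxE eqxx andbT eq_sym (negPf njk) mulr0.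
Qed.

Lemma total_volumeZ (R : realType) (n : nat) (c : R) (A : 'M[R]_n.*2) :
  total_volume (c *: A) = c ^+ n * total_volume A.
Proof.
have wedge_powZ k (v : 'I_k.*2 -> 'cV[R]_n.*2) :
    wedge_pow (two_form (c *: A)) v = c ^+ k * wedge_pow (two_form A) v.
  elim: k v => [|k IH] v /=; first by rewrite mulr1.
  rewrite /wedge [RHS]mulrCA; congr (_ * _); rewrite mulr_sumr.
  apply: eq_bigr => s _; rewrite IH /two_form /bilin -scalemxAr -scalemxAl.
  rewrite mxE exprS mulrACA.
  exact: mulrCA.
exact: wedge_powZ.
Qed.

(** * Continuity of matrix operations and of the volume *)

Lemma cvg_sum_fin (R : realType) (T : Type) (F : set_system T)
    {FF : Filter F} (I : finType)
    (f : I -> T -> R) (a : I -> R) :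
  (forall i, f i x @[x --> F] --> a i) ->
  \sum_i f i x @[x --> F] --> \sum_i a i.
Proof. by move=> fa; apply: cvg_big => //; exact: add_continuous. Qed.

Lemma cvg_mx (R : realType) (m n : nat) (T : Type) (F : set_system T)
    {FF : Filter F} (f : T -> 'M[R]_(m, n)) (A : 'M[R]_(m, n)) :
  (forall i j, f x i j @[x --> F] --> A i j) -> f x @[x --> F] --> A.
Proof.
move=> fA B [P nbhsP PB].
have : \forall x \near F, forall i j, P i j (f x i j).
  by apply: filter_forall => i; apply: filter_forall => j; exact: (fA i j).
by apply: filterS => x Px; exact: PB.
Qed.

Lemma cvg_mulmx (R : realType) (m n p : nat) (T : Type) (F : set_system T)
    {FF : Filter F} (f : T -> 'M[R]_(m, n)) (g : T -> 'M[R]_(n, p))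
    (A : 'M[R]_(m, n)) (B : 'M[R]_(n, p)) :
  f x @[x --> F] --> A -> g x @[x --> F] --> B ->
  f x *m g x @[x --> F] --> A *m B.
Proof.
move=> fA gB; apply: cvg_mx => i j; rewrite mxE.
under eq_fun do rewrite mxE.
apply: cvg_sum_fin => k; apply: cvgM.
- exact: (cvg_comp _ _ fA (@coord_continuous _ _ _ i k A)).
- exact: (cvg_comp _ _ gB (@coord_continuous _ _ _ k j B)).
Qed.

Lemma cvg_trmx (R : realType) (m n : nat) (T : Type) (F : set_system T)
    {FF : Filter F} (f : T -> 'M[R]_(m, n)) (A : 'M[R]_(m, n)) :
  f x @[x --> F] --> A -> (f x)^T @[x --> F] --> A^T.
Proof.
move=> fA; apply: cvg_mx => i j; rewrite mxE.
under eq_fun do rewrite mxE.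
exact: (cvg_comp _ _ fA (@coord_continuous _ _ _ j i A)).
Qed.

Lemma cvg_floor_div (R : realType) (x : R) :
  k.+1%:R^-1 * (Num.floor (k.+1%:R * x))%:~R @[k --> \oo] --> x.
Proof.
apply: (squeeze_cvgr (f := fun k : nat => x - harmonic k) (h := fun=> x)).
- near=> k; rewrite /harmonic /= ler_pdivrMl ?ltr0n // floor_le_tmp andbT.
  rewrite -(ler_pM2l (ltr0Sn R k)) mulVKf ?pnatr_eq0 // mulrBr.
  rewrite divff ?pnatr_eq0 //.
  by rewrite lerBlDr ltW // -[1]/(1%:~R) -intrD floorD1_gt.
- rewrite -[X in _ --> X]subr0; apply: cvgB; first exact: cvg_cst.
  exact: cvg_harmonic.
- exact: cvg_cst.
Unshelve. all: by end_near. Qed.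

Lemma continuous_total_volume (R : realType) (n : nat) :
  continuous (@total_volume R n).
Proof.
have cont_bilin (u v : 'cV[R]_n.*2) : continuous (fun A => bilin A u v).
  move=> A.
  have cvgA : u^T *m B *m v @[B --> A] --> u^T *m A *m v.
    apply: (cvg_mulmx (F := nbhs A)); last exact: cvg_cst.
    by apply: (cvg_mulmx (F := nbhs A)); [exact: cvg_cst | exact: cvg_id].
  exact: (cvg_comp _ _ cvgA (@coord_continuous _ _ _ 0 0 _)).
have cont_pow k (v : 'I_k.*2 -> 'cV[R]_n.*2) :
    continuous (fun A : 'M[R]_n.*2 => wedge_pow (two_form A) v).
  elim: k v => [|k IH] v A; first exact: (@cvg_cst _ _ _ (nbhs A)).
  apply: (@cvgM _ _ (nbhs A)); first exact: cvg_cst.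
  apply: (cvg_sum_fin (F := nbhs A)) => s.
  apply: (@cvgM _ _ (nbhs A)); first exact: cvg_cst.
  by apply: (@cvgM _ _ (nbhs A)); [exact: cont_bilin | exact: IH].
exact: cont_pow.
Qed.

(** * Forms and their volume *)

Lemma mulmx_colP (R : realType) (m n : nat) (A B : 'M[R]_(m, n)) :
  (forall v : 'cV[R]_n, A *m v = B *m v) -> A = B.
Proof.
by move=> eqAB; apply/trmx_inj/row_matrixP => j; rewrite -!tr_col !colE eqAB.
Qed.

Lemma bilin_delta (R : realType) (m : nat) (A : 'M[R]_m) (i j : 'I_m) :
  bilin A (delta_mx i 0) (delta_mx j 0) = A i j.
Proof. by rewrite /bilin trmx_delta -rowE -colE !mxE. Qed.

Lemma bilinT (R : realType) (m : nat) (A : 'M[R]_m) (u v : 'cV[R]_m) :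
  bilin A^T u v = bilin A v u.
Proof.
rewrite /bilin; transitivity ((v^T *m A *m u)^T 0 0); last by rewrite mxE.
by rewrite !trmx_mul trmxK mulmxA.
Qed.

Lemma alternating_formP (R : realType) (m : nat) (A : 'M[R]_m) :
  alternating_form A <-> A^T = - A.
Proof.
split=> [altA|AT u].
  apply/matrixP => i j; rewrite !mxE -!bilin_delta.
  set u := delta_mx j 0; set v := delta_mx i 0.
  have bDl a b c : bilin A (a + b) c = bilin A a c + bilin A b c.
    by rewrite /bilin (_ : (a + b)^T = a^T + b^T) ?raddfD // !mulmxDl mxE.
  have bDr a b c : bilin A c (a + b) = bilin A c a + bilin A c b.
    by rewrite /bilin mulmxDr mxE.
  have := altA (u + v); rewrite bDl !bDr !altA add0r addr0 => /eqP.
  by rewrite addr_eq0 => /eqP.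
apply/eqP; have : bilin A u u = - bilin A u u.
  by rewrite -{1}bilinT AT /bilin mulmxN mulNmx mxE.
by move/eqP; rewrite -addr_eq0 -mulr2n mulrn_eq0.
Qed.

Lemma mulmx_trmx_self_eq0 (R : realType) (m n : nat) (A : 'M[R]_(m, n)) :
  A^T *m A = 0 -> A = 0.
Proof.
move=> AA0; apply/matrixP => i j; rewrite [RHS]mxE.
have /matrixP /(_ j j) := AA0; rewrite [RHS]mxE mxE => /eqP.
rewrite psumr_eq0 => [/allP /(_ i)|k _]; last by rewrite mxE -expr2 sqr_ge0.
by rewrite mem_index_enum mxE mulf_eq0 orbb => /(_ isT) /eqP.
Qed.

(** If [u != 0] is in the radical of [A], then [A] is invariant under the
    orthogonal projection [g] along [u]; as [\det g = 0], the volume of [A]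
    vanishes. *)
Lemma nondegenerate_total_volume (R : realType) (n : nat) (A : 'M[R]_n.*2) :
  alternating_form A -> total_volume A != 0 -> nondegenerate_form A.
Proof.
move=> /alternating_formP AT volA u uA; apply: contraNeq volA => u0.
have uA0 : u^T *m A = 0.
  apply/rowP => j; rewrite [RHS]mxE -[RHS](uA (delta_mx j 0)) /bilin.
  by rewrite -colE !mxE.
have Au0 : A *m u = 0.
  by rewrite -[A]opprK -AT mulNmx -[u]trmxK -trmx_mul uA0 trmx0 oppr0.
pose q := (u^T *m u) 0 0.
have q0 : q != 0.
  apply: contraNneq u0 => q0; apply/eqP/mulmx_trmx_self_eq0.
  by rewrite [LHS]mx11_scalar -/q q0 raddf0.
pose g := 1%:M - q^-1 *: (u *m u^T).
have Ag : A *m g = A.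
  by rewrite mulmxBr mulmx1 -scalemxAr mulmxA Au0 mul0mx scaler0 subr0.
have gA : change_var g A = A.
  rewrite /change_var -mulmxA Ag -[A]opprK -AT mulmxN -trmx_mul Ag.
  by rewrite AT.
have gu : g *m u = 0.
  rewrite mulmxBl mul1mx -scalemxAl -mulmxA [u^T *m u]mx11_scalar -/q.
  by rewrite mul_mx_scalar scalerA mulVf // scale1r subrr.
have detg : \det g = 0.
  apply: contraNeq u0 => detg.
  have gU : g \in unitmx by rewrite unitmxE unitfE.
  by rewrite -[u](mulKmx gU) gu mulmx0.
by rewrite -gA total_volume_change_var detg mul0r.
Qed.

(** * Shears *)

(** Sylvester's identity, from the two products of [S] and [U] below. *)
Lemma det_1addM (R : realType) (m n : nat) (A : 'M[R]_(m, n))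
    (B : 'M[R]_(n, m)) : \det (1%:M + A *m B) = \det (1%:M + B *m A).
Proof.
pose S := block_mx 1%:M (- A) B 1%:M.
pose U := block_mx (1%:M : 'M[R]_m) A 0 (1%:M : 'M[R]_n).
have detU : \det U = 1 by rewrite det_ublock !det1 mulr1.
have : \det (U *m S) = \det (S *m U) by rewrite !det_mulmx mulrC.
rewrite !mulmx_block !mul1mx !mulmx1 !mul0mx !mulmx0 addNr addrC !add0r addr0.
by rewrite subrr det_lblock det_lblock !det1 mulr1 mul1r [1%:M + B *m A]addrC.
Qed.

(** As [N] maps into the image of [P] and [Q] kills this image, both [N] and
    [W], which factor through [Q], vanish on the image of [N]. *)
Section Shear.
Variables (R : realType) (m : nat) (P Q N W : 'M[R]_m).
Hypotheses (QP : Q *m P = 0) (PN : P *m N = N) (NQ : N *m Q = N).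
Hypothesis WQ : W *m Q = W.

Lemma det_shear : \det (1%:M + N) = 1.
Proof.
by rewrite -{1}PN -{1}NQ mulmxA det_1addM mulmxA QP !mul0mx addr0 det1.
Qed.

Lemma change_var_shear :
  change_var (1%:M + N) (W - W^T) = W - W^T + (N^T *m W - W^T *m N).
Proof.
have WN : W *m N = 0 by rewrite -WQ -PN -mulmxA (mulmxA Q) QP mul0mx mulmx0.
rewrite /change_var; have NWT : N^T *m W^T = 0 by rewrite -trmx_mul WN trmx0.
have -> : (1%:M + N)^T = 1%:M + N^T by rewrite raddfD /= trmx1.
rewrite mulmxDl mul1mx mulmxBr NWT subr0.
rewrite mulmxDr mulmx1 mulmxDl mulmxBl WN sub0r -mulmxA WN mulmx0 addr0.
by rewrite addrA.
Qed.
End Shear.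

(** Nondegeneracy makes the rows of [P] combinations of those of [X^T], so that
    [X] has at least the rank of [P], hence that of [Q]; being of the form
    [X Q], it has the row space of [Q]. Multiplying by [P] on the left does not
    reduce this row space, because [P] is injective on the image of [P^T]. Thus
    [Q = M P X] for some [M], so that [(P X)^T M^T = Q^T], which fixes [C]. *)
Lemma mixed_block_preimage (R : realType) (m : nat) (P Q X C : 'M[R]_m)
    (s : R) :
  P *m P = P -> Q *m P = 0 -> (\rank Q <= \rank P)%N ->
  P^T *m X = X -> X *m Q = X -> Q^T *m C = C -> C *m Q = C ->
  s *: (X - X^T) + C \in unitmx ->
  exists D, [/\ P^T *m D = D, D *m Q = D & (P *m X)^T *m D = 2^-1 *: C].
Proof.
move=> PP QP rQP PX XQ QC CQ; set A := _ + C => Aunit.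
have XP : X *m P = 0 by rewrite -XQ -mulmxA QP mulmx0.
have CP : C *m P = 0 by rewrite -CQ -mulmxA QP mulmx0.
have XTP : X^T *m P = X^T.
  by rewrite -{1}PX trmx_mul trmxK -{2}PX trmx_mul trmxK -mulmxA PP.
have PXT : (P <= X^T)%MS.
  apply/submxP; exists (- s *: invmx A).
  rewrite -[P in LHS](mulKmx Aunit) /A mulmxDl CP addr0 -scalemxAl mulmxBl XP.
  by rewrite sub0r XTP -!scalemxAr -scalemxAl mulmxN scaleNr scalerN.
have QX : (Q <= X)%MS.
  have XleQ : (X <= Q)%MS by rewrite -XQ submxMl.
  rewrite -(geq_leqif (mxrank_leqif_sup XleQ)).
  by rewrite (leq_trans rQP) // -(mxrank_tr X) mxrankS.
(* If [P X Z = 0], then [(X Z)^T X Z = (X Z)^T P X Z = 0], as [P^T X = X]. *)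
have XPX : (X <= P *m X)%MS.
  rewrite submxE; apply/eqP; set Z := cokermx _.
  have PXZ : P *m (X *m Z) = 0 by rewrite mulmxA mulmx_coker.
  apply: mulmx_trmx_self_eq0; rewrite -{1}PX -mulmxA trmx_mul trmxK -mulmxA.
  by rewrite PXZ mulmx0.
have /submxP[M QM] := submx_trans QX XPX.
exists (2^-1 *: (P^T *m M^T *m C)); split.
- by rewrite -scalemxAr !mulmxA -trmx_mul PP.
- by rewrite -scalemxAl -mulmxA CQ.
- rewrite -scalemxAr; congr (_ *: _).
  rewrite !mulmxA -!trmx_mul (mulmxA P P) PP -QM.
  exact: QC.
Qed.

(** * The integral projection onto one of two complementary subspaces *)

Lemma mxrank_le_dim (R : realType) (m p : nat) (U : {vspace 'cV[R]_m})
    (M : 'M[R]_(m, p)) :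
  (forall v, M *m v \in U) -> (\rank M <= \dim U)%N.
Proof.
move=> MU; pose B := \matrix_(i < m, j < \dim U) (vbasis U)`_j i 0.
pose K := \matrix_(j < \dim U, k < p) coord (vbasis U) j (col k M).
have -> : M = B *m K.
  apply/matrixP => i k; rewrite -[LHS]/(M i k).
  have Mk : col k M \in U by rewrite colE MU.
  have := congr1 (fun v : 'cV_m => v i 0) (coord_vbasis Mk).
  rewrite mxE summxE => ->; rewrite mxE; apply: eq_bigr => j _.
  by rewrite !mxE mulrC.
by rewrite (leq_trans (mxrankM_maxl _ _)) // rank_leq_col.
Qed.

(** The columns of the projection are the components in [l] of the standard
    basis vectors, which complementarity provides as integral vectors. It also
    implies that the two subspaces span the whole space, so that by their
    dimensions they meet only at 0, which makes the matrix act as a projection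
    on them. *)
Lemma integral_projection (R : realType) (m : nat) (l l' : {vspace 'cV[R]_m}) :
  (\dim l + \dim l' = m)%N -> complementary l l' ->
  exists P : 'M[R]_m,
    [/\ P \is a mxOver Num.int, forall v, P *m v \in l,
        forall v, v - P *m v \in l', forall v, v \in l -> P *m v = v &
        forall v, v \in l' -> P *m v = 0].
Proof.
move=> dim_ll' [decomp _].
have : forall j : 'I_m, exists u : 'cV[R]_m,
    [/\ u \in l, integral_vec u & delta_mx j 0 - u \in l'].
  move=> j; have [|u [u' [[ul uZ] [ul' _] juu']]] := decomp (delta_mx j 0).
    by apply/mxOverP => i k; rewrite mxE; exact: intr_int (_ : bool).
  by exists u; split=> //; rewrite juu' addrC addKr.
move=> /choice[f fP].
pose P := \matrix_(i < m, j < m) f j i 0.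
have PE v : P *m v = \sum_j v j 0 *: f j.
  apply/colP => i; rewrite mxE summxE; apply: eq_bigr => j _.
  by rewrite !mxE mulrC.
have Pl v : P *m v \in l.
  by rewrite PE; apply: rpred_sum => j _; apply: rpredZ; have [] := fP j.
have Pl' v : v - P *m v \in l'.
  rewrite PE [X in X - _](_ : v = \sum_j v j 0 *: delta_mx j 0).
    rewrite -sumrB; apply: rpred_sum => j _; rewrite -scalerBr.
    by apply: rpredZ; have [] := fP j.
  rewrite [LHS]matrix_sum_delta; apply: eq_bigr => j _.
  by rewrite big_ord_recl big_ord0 addr0.
have cap0 : (l :&: l')%VS = 0%VS.
  have sumf : (l + l')%VS = fullv.
    apply/eqP; rewrite eqEsubv subvf; apply/subvP => v _.
    by rewrite -[v](subrK (P *m v)) addrC memv_add.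
  apply/eqP; rewrite -dimv_eq0; have := dimv_sum_cap l l'.
  rewrite sumf dimvf dim_ll' /dim /= muln1 => /eqP.
  by rewrite -[X in _ == X]addn0 eqn_add2l.
have cap v : v \in l -> v \in l' -> v = 0.
  by move=> vl vl'; apply/eqP; rewrite -memv0 -cap0 memv_cap vl vl'.
exists P; split=> //.
- by apply/mxOverP => i j; rewrite mxE; have [_ /mxOverP + _] := fP j; apply.
- move=> v vl; apply/esym/eqP; rewrite -subr_eq0; apply/eqP/cap => //.
  by rewrite rpredB.
- move=> v vl'; apply: cap => //.
  by rewrite -[P *m v](subKr v) rpredB.
Qed.

(** * Normalizing the volume *)

Lemma change_varZ (R : realType) (m : nat) (c : R) (g A : 'M[R]_m) :
  change_var g (c *: A) = c *: change_var g A.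
Proof. by rewrite /change_var -scalemxAr -scalemxAl. Qed.

Lemma alternating_change_var (R : realType) (m : nat) (g A : 'M[R]_m) :
  alternating_form A -> alternating_form (change_var g A).
Proof. by move=> altA u; rewrite bilin_change_var. Qed.

Lemma unit_volume_formsP (R : realType) (n : nat) (A : 'M[R]_n.*2) :
  unit_volume_forms A <-> alternating_form A /\ total_volume A = 1.
Proof.
split=> [[[? _ _] ?]//|[altA volA]]; split=> //; split=> //.
- by apply: nondegenerate_total_volume; rewrite // volA oner_eq0.
- by rewrite volA.
Qed.

Lemma nondegenerate_unitmx (R : realType) (m : nat) (A : 'M[R]_m) :
  nondegenerate_form A -> A \in unitmx.
Proof.
move=> ndA; rewrite -row_free_unit -kermx_eq0; apply/rowV0P => v /sub_kermxP vA.
apply/trmx_inj; rewrite trmx0; apply: ndA => w.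
by rewrite /bilin trmxK vA mul0mx mxE.
Qed.

Lemma lagrangian_change_var (R : realType) (n : nat)
    (l : {vspace 'cV[R]_n.*2}) (g A : 'M[R]_n.*2) :
  fixing_group l g -> lagrangian_forms l A ->
  lagrangian_forms l (change_var g A).
Proof.
move=> [detg gl] [/unit_volume_formsP[altA volA] lagA]; split.
  apply/unit_volume_formsP; split; first exact: alternating_change_var.
  by rewrite total_volume_change_var detg mul1r.
by move=> u v ul vl; rewrite bilin_change_var !gl // lagA.
Qed.

(** The factor is the [n]-th root of the inverse volume. For [n = 0] the
    division by [n] gives the factor 1, which is correct since the volume is
    then 1. *)
Definition normalize_volume (R : realType) (n : nat) (A : 'M[R]_n.*2) :
    'M[R]_n.*2 :=
  expR (- (n%:R^-1 * ln (total_volume A))) *: A.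

Lemma total_volume_normalize (R : realType) (n : nat) (A : 'M[R]_n.*2) :
  0 < total_volume A -> total_volume (normalize_volume A) = 1.
Proof.
rewrite total_volumeZ; case: n A => [|n] A volA; first by rewrite expr0 mul1r.
rewrite -expRM_natl mulrN mulVKf ?pnatr_eq0 // expRN lnK //.
by rewrite mulVf ?gt_eqF.
Qed.

Lemma normalize_volume_id (R : realType) (n : nat) (A : 'M[R]_n.*2) :
  total_volume A = 1 -> normalize_volume A = A.
Proof.
by move=> volA; rewrite /normalize_volume volA ln1 mulr0 oppr0 expR0 scale1r.
Qed.

Lemma cvg_normalize_volume (R : realType) (n : nat) (A : 'M[R]_n.*2) :
  0 < total_volume A -> normalize_volume B @[B --> A] --> normalize_volume A.
Proof.
move=> volA; apply: (@cvgZ _ _ _ (nbhs A)); last exact: cvg_id.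
have cvgE : - (n%:R^-1 * ln (total_volume B)) @[B --> A] -->
    - (n%:R^-1 * ln (total_volume A)).
  apply: (@cvgN _ _ _ (nbhs A)).
  apply: (@cvgM _ _ (nbhs A)); first exact: cvg_cst.
  exact: (cvg_comp _ _ (@continuous_total_volume R n A) (continuous_ln volA)).
exact: (cvg_comp _ _ cvgE (@continuous_expR R _)).
Qed.

(** * Approximation by images of split forms *)

Section Density.
Variables (R : realType) (n : nat) (l l' : {vspace 'cV[R]_n.*2}).
Variables P Q : 'M[R]_n.*2.
Hypothesis PDQ : P + Q = 1%:M.
Hypothesis P_int : P \is a mxOver Num.int.
Hypothesis P_l : forall v, P *m v \in l.
Hypothesis Q_l' : forall v, v - P *m v \in l'.
Hypothesis P_id : forall v, v \in l -> P *m v = v.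
Hypothesis P_0 : forall v, v \in l' -> P *m v = 0.
Hypothesis dim_l' : \dim l' = n.

Let QE : Q = 1%:M - P. Proof. by rewrite -PDQ addrC addKr. Qed.

Let PP : P *m P = P.
Proof. by apply: mulmx_colP => v; rewrite -mulmxA P_id. Qed.

Let QP : Q *m P = 0. Proof. by rewrite QE mulmxBl mul1mx PP subrr. Qed.
Let PQ : P *m Q = 0. Proof. by rewrite QE mulmxBr mulmx1 PP subrr. Qed.
Let QQ : Q *m Q = Q. Proof. by rewrite {1}QE mulmxBl mul1mx PQ subr0. Qed.

(** The image of [Q] is in [l'], so its rank is at most [n]; the ranks of [P]
    and [Q] add up to at least [2 n]. *)
Let rank_Q : (\rank Q <= \rank P)%N.
Proof.
have rQ : (\rank Q <= n)%N.
  rewrite -[leqRHS]dim_l'; apply: mxrank_le_dim => v.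
  by rewrite QE mulmxBl mul1mx.
have : (n + n <= \rank P + \rank Q)%N.
  by rewrite addnn -[leqLHS](mxrank1 R n.*2) -PDQ mxrank_add.
move=> /leq_trans/(_ (leq_add (leqnn _) rQ)); rewrite leq_add2r.
exact: leq_trans.
Qed.

(** The orbits of the split forms, up to the normalization of the volume; here
    [W - W^T] may even be degenerate. *)
Definition split_reachable (B : 'M[R]_n.*2) : Prop :=
  exists g W, [/\ integral_fixing_group l g, P^T *m W = W, W *m Q = W &
                  B = change_var g (W - W^T)].

Let alternating_antisym (W : 'M[R]_n.*2) : alternating_form (W - W^T).
Proof. by apply/alternating_formP; rewrite raddfB /= trmxK opprB. Qed.

Let split_lagrangian (W : 'M[R]_n.*2) :
  P^T *m W = W -> W *m Q = W -> total_volume (W - W^T) = 1 ->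
  lagrangian_split_forms l l' (W - W^T).
Proof.
move=> PW WQ volW.
have unitW : unit_volume_forms (W - W^T).
  by apply/unit_volume_formsP.
have WP : W *m P = 0 by rewrite -WQ -mulmxA QP mulmx0.
have WTP : P^T *m W^T = 0 by rewrite -trmx_mul WP trmx0.
have WTQ : Q^T *m W^T = W^T by rewrite -trmx_mul WQ.
have QW : Q^T *m W = 0 by rewrite -PW mulmxA -trmx_mul PQ trmx0 mul0mx.
have PWP : P^T *m (W - W^T) *m P = 0.
  by rewrite mulmxBr PW WTP subr0 WP.
have QWQ : Q^T *m (W - W^T) *m Q = 0.
  have WTQ0 : W^T *m Q = 0 by apply: trmx_inj; rewrite trmx_mul trmxK QW trmx0.
  by rewrite mulmxBr QW WTQ sub0r mulNmx WTQ0 oppr0.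
have lag_of (M : 'M[R]_n.*2) (U : {vspace 'cV[R]_n.*2}) :
    M^T *m (W - W^T) *m M = 0 -> (forall v, v \in U -> M *m v = v) ->
    forall u v, u \in U -> v \in U -> bilin (W - W^T) u v = 0.
  move=> M0 MU u v uU vU; rewrite -(MU u uU) -(MU v vU) -bilin_change_var.
  by rewrite /change_var M0 /bilin mulmx0 mul0mx mxE.
split; split=> //; first exact: (lag_of P).
by apply: (lag_of Q) => // v vl'; rewrite QE mulmxBl mul1mx P_0 // subr0.
Qed.

Lemma normalize_reachable (B : 'M[R]_n.*2) :
  split_reachable B -> 0 < total_volume B ->
  (\bigcup_(A in lagrangian_split_forms l l')
      orbit_of (integral_fixing_group l) A) (normalize_volume B).
Proof.
move=> [g [W [gG PW WQ ->]]] volB; rewrite /normalize_volume.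
have := total_volume_normalize volB; rewrite /normalize_volume.
set c := expR _; rewrite -change_varZ scalerBr.
have -> : c *: W^T = (c *: W)^T by apply/matrixP => i j; rewrite !mxE.
have [[detg _] _] := gG; rewrite total_volume_change_var detg mul1r => volW.
exists (c *: W - (c *: W)^T); last by exists g.
by apply: split_lagrangian; rewrite -?scalemxAr -?scalemxAl ?PW ?WQ.
Qed.

(** The shear is [1 + k.+1 P X], applied to the split form of mixed block
    [s X + D / k.+1]. *)
Let rational_reachable (X C : 'M[R]_n.*2) (s : R) :
  X \is a mxOver Num.int -> P^T *m X = X -> X *m Q = X ->
  C^T = - C -> Q^T *m C = C -> C *m Q = C ->
  s *: (X - X^T) + C \in unitmx ->
  closure split_reachable (s *: (X - X^T) + C).
Proof.
move=> X_int PX XQ CT QC CQ Aunit.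
have [D [PD DQ ND]] := mixed_block_preimage PP QP rank_Q PX XQ QC CQ Aunit.
pose B (k : nat) := s *: (X - X^T) + C + harmonic k *: (D - D^T).
have B_cvg : B k @[k --> \oo] --> s *: (X - X^T) + C.
  rewrite -[X in _ --> X]addr0 -[X in _ + X](scale0r (D - D^T)).
  apply: cvgD; first exact: cvg_cst.
  by apply: cvgZr_tmp; exact: cvg_harmonic.
have BS k : split_reachable (B k).
  pose N := k.+1%:R *: (P *m X); pose W := s *: X + harmonic k *: D.
  have PN : P *m N = N by rewrite -scalemxAr mulmxA PP.
  have NQ : N *m Q = N by rewrite -scalemxAl -mulmxA XQ.
  have WQ : W *m Q = W by rewrite mulmxDl -!scalemxAl XQ DQ.
  have PW : P^T *m W = W by rewrite mulmxDr -!scalemxAr PX PD.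
  have gZ : 1%:M + N \is a mxOver Num.int.
    have /mxOverP PX_int : P *m X \is a mxOver Num.int by rewrite mxOverM.
    apply/mxOverP => i j; rewrite [X in X \in _]mxE [N i j]mxE [1%:M i j]mxE.
    by rewrite rpredD ?rpred_nat // rpredM ?rpred_nat.
  exists (1%:M + N), W; split=> //.
    split; [split|].
    - exact: (det_shear QP PN NQ).
    - move=> v vl; rewrite mulmxDl mul1mx -NQ -(P_id vl) mulmxA.
      by rewrite -(mulmxA N) QP mulmx0 mul0mx addr0.
    - exact: gZ.
  rewrite (change_var_shear QP PN WQ).
  (* [X^T P X = X^T X] is symmetric: only the correction survives in the
     difference of the next two products. *)
  have NW : N^T *m W = (k.+1%:R * s) *: (X^T *m X) + 2^-1 *: C.
    have NT : N^T = k.+1%:R *: (P *m X)^T by apply/matrixP => i j; rewrite !mxE.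
    rewrite NT mulmxDr -!scalemxAl -!scalemxAr scalerA ND.
    rewrite trmx_mul -mulmxA PX !scalerA; congr (_ *: _ + _ *: _).
    by rewrite divff ?pnatr_eq0 // mul1r.
  have WN : W^T *m N = (k.+1%:R * s) *: (X^T *m X) - 2^-1 *: C.
    rewrite -[W^T *m N]trmxK trmx_mul trmxK NW; apply/matrixP => i j.
    have /matrixP/(_ i j) := CT; rewrite !mxE => ->; rewrite mulrN.
    by congr (_ * _ - _); apply: eq_bigr => ? _; rewrite !mxE mulrC.
  rewrite NW WN /B /W.
  apply/matrixP => i j; rewrite !mxE; lra.
move=> U nbhsU; have : \forall k \near \oo, U (B k) by exact: B_cvg.
move=> [k _ /(_ k (leqnn k)) UBk].
by exists (B k); split.
Qed.

(** The approximants are nondegenerate once they are so close to [A] that their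
    volume is positive. *)
Lemma closure_split_reachable (A : 'M[R]_n.*2) :
  lagrangian_forms l A -> closure split_reachable A.
Proof.
move=> [/unit_volume_formsP[altA volA] lagA].
have AT := (alternating_formP A).1 altA.
have PAP : P^T *m A *m P = 0.
  apply/matrixP => i j; rewrite -bilin_delta -/(change_var P A).
  by rewrite bilin_change_var lagA // mxE.
pose W := P^T *m A *m Q; pose C := Q^T *m A *m Q.
have WT : W^T = - (Q^T *m A *m P).
  by rewrite !trmx_mul trmxK AT mulNmx mulmxN mulmxA.
have AE : A = W - W^T + C.
  have PTQ : P^T + Q^T = 1%:M.
    by have := congr1 trmx PDQ; rewrite trmx1 raddfD.
  rewrite WT opprK -[LHS]mulmx1 -PDQ -[LHS]mul1mx -PTQ.
  by rewrite mulmxDl !mulmxDr !mulmxA PAP add0r addrA.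
have CT : C^T = - C.
  by rewrite !trmx_mul trmxK AT mulNmx mulmxN mulmxA.
have QC : Q^T *m C = C by rewrite !mulmxA -trmx_mul QQ.
have CQ : C *m Q = C by rewrite /C -mulmxA QQ.
pose X k := P^T *m map_mx (fun x => (Num.floor (k.+1%:R * x))%:~R) W *m Q.
pose B k := harmonic k *: (X k - (X k)^T) + C.
have X_cvg : harmonic k *: X k @[k --> \oo] --> W.
  rewrite [X in _ --> X](_ : W = P^T *m W *m Q); last first.
    by rewrite !mulmxA -trmx_mul PP -mulmxA QQ.
  under eq_fun do rewrite scalemxAl scalemxAr.
  apply: cvg_mulmx; last exact: cvg_cst.
  apply: cvg_mulmx; first exact: cvg_cst.
  apply: cvg_mx => i j; under eq_fun do rewrite mxE [X in _ * X]mxE.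
  exact: cvg_floor_div.
have B_cvg : B k @[k --> \oo] --> A.
  rewrite AE; apply: cvgD; last exact: cvg_cst.
  under eq_fun do rewrite scalerBr.
  apply: cvgB; first exact: X_cvg.
  have -> : (fun k => harmonic k *: (X k)^T) = (fun k => (harmonic k *: X k)^T).
    by apply/funext => k; apply/matrixP => i j; rewrite !mxE.
  exact: cvg_trmx.
have near_pos : \forall k \near \oo, 0 < total_volume (B k).
  have := cvg_comp _ _ B_cvg (@continuous_total_volume R n A).
  by move/cvgr_gt; apply; rewrite volA.
have near_closure : \forall k \near \oo, closure split_reachable (B k).
  near=> k.
  have volB : 0 < total_volume (B k) by near: k.
  apply: rational_reachable => //.
  - rewrite mxOverM ?mxOverM //.
    + by apply/mxOverP => i j; rewrite mxE; have /mxOverP := P_int; apply.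
    + by apply/mxOverP => i j; rewrite mxE intr_int.
    + apply/mxOverP => i j; rewrite QE !mxE rpredB ?rpred_nat //.
      by have /mxOverP := P_int; apply.
  - by rewrite !mulmxA -trmx_mul PP.
  - by rewrite -mulmxA QQ.
  - apply/nondegenerate_unitmx/nondegenerate_total_volume.
      2: by rewrite gt_eqF.
    apply/alternating_formP; apply/matrixP => i j.
    by have /matrixP/(_ i j) := CT; rewrite !mxE => ->; ring.
apply: closed_closure => U nbhsU.
have [k _ kP] : \forall k \near \oo, closure split_reachable (B k) /\ U (B k).
  by near=> k; split; near: k; [exact: near_closure | exact: B_cvg].
by exists (B k); exact: (kP k (leqnn k)).
Unshelve. all: by end_near. Qed.

End Density.

Theorem proposition1p4 (R : realType) (n : nat)
    (l l' : {vspace 'cV[R]_n.*2})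
    (dim_l : \dim l = n) (dim_l' : \dim l' = n)
    (rat_l : rational_subspace l) (rat_l' : rational_subspace l')
    (compl_ll' : complementary l l') :
  dense_in
    (\bigcup_(A in lagrangian_split_forms l l')
       orbit_of (integral_fixing_group l) A)
    (lagrangian_forms l).
Proof.
split=> [_ [A [lagA _] [g [gG _] <-]]|A lagA].
  exact: lagrangian_change_var.
have dim_ll' : (\dim l + \dim l' = n.*2)%N by rewrite dim_l dim_l' addnn.
have [P [P_int P_l Q_l' P_id P_0]] := integral_projection dim_ll' compl_ll'.
have PDQ : P + (1%:M - P) = 1%:M by rewrite addrC subrK.
have [/unit_volume_formsP[_ volA] _] := lagA.
have volA0 : 0 < total_volume A by rewrite volA.
move=> U nbhsU.
(* Near [A] the volume is positive and the normalization lands in [U]. *)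
have : \forall B \near A, U (normalize_volume B) /\ 0 < total_volume B.
  near=> B; split; near: B.
    by apply: (cvg_normalize_volume volA0); rewrite normalize_volume_id.
  exact: (cvgr_gt _ (@continuous_total_volume R n A) _ volA0).
move=> /(closure_split_reachable PDQ P_int P_l Q_l' P_id dim_l' lagA).
move=> [B [reachB [UB volB]]]; exists (normalize_volume B); split=> //.
exact: (normalize_reachable PDQ P_l P_id P_0 reachB volB).
Unshelve. all: by end_near. Qed.
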